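(* (a) For all integers $a,b$ with $1\le a<b$ there exists an integer $n$ with $0\le n\le \frac{5}{3}b$ such that $\mathbf{t}[n]\notin\{\mathbf{t}[n+a],\mathbf{t}[n+b]\}$. (b) The bound in (a) is optimal in the following sense: for every $m$ there exist integers $a,b$ with $1\le a<b$ and $b>m$ such that $\mathbf{t}[i]\in\{\mathbf{t}[i+a],\mathbf{t}[i+b]\}$ for every integer $i$ with $0\le i<\frac{5}{3}b$; hence if the bound $\frac53 b$ is reduced, there are infinitely many counterexamples.
   Context: The Thue–Morse sequence $\mathbf{t}=01101001\cdots$ is the infinite fixed point, starting with $0$, of the morphism $0\mapsto01$, $1\mapsto10$; it is indexed from $0$. *)

(* Defs.v *)
From mathcomp Require Import all_boot.

Set Implicit Arguments.
Unset Strict Implicit.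
Unset Printing Implicit Defensive.

(* The letters 0 and 1 are represented by false and true. *)
Definition tm_letter (c : bool) : seq bool :=
  if c then [:: true; false] else [:: false; true].

Definition tm_morphism (w : seq bool) : seq bool := flatten (map tm_letter w).

(* The n-th iterate of the morphism on the word 0 has length 2 ^ n > n and is a
   prefix of all later iterates, so its n-th letter is that of their limit, the
   infinite fixed point. [is_tm_fixpoint] and the lemmas below characterize
   [thue_morse] as the unique infinite fixed point that starts with 0. *)
Definition thue_morse (n : nat) : bool :=
  nth false (iter n tm_morphism [:: false]) n.

(* An infinite word is fixed by the morphism when the image of each of its
   finite prefixes is again one of its prefixes. *)
Definition is_tm_fixpoint (t : nat -> bool) : Prop :=
  forall n, tm_morphism (mkseq t n) = mkseq t (size (tm_morphism (mkseq t n))).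

Lemma size_tm_morphism w : size (tm_morphism w) = (size w).*2.
Proof. by elim: w => //= -[] w /= ->. Qed.

Lemma nth_tm_morphism w i : i < (size w).*2 ->
  nth false (tm_morphism w) i = odd i (+) nth false w i./2.
Proof.
elim: w i => //= c w IHw [|[|i]]; case: c => //=; rewrite doubleS !ltnS => /IHw.
  by rewrite negbK.
by rewrite negbK.
Qed.

Lemma size_iter_tm n : size (iter n tm_morphism [:: false]) = 2 ^ n.
Proof. by elim: n => //= n IHn; rewrite size_tm_morphism IHn expnS mul2n. Qed.

Lemma nth_iter_tmS n i : i < 2 ^ n ->
  nth false (iter n.+1 tm_morphism [:: false]) i =
  nth false (iter n tm_morphism [:: false]) i.
Proof.
elim: n i => [|n IHn] i lti; first by case: i lti.
have lti2 : i./2 < 2 ^ n by rewrite ltn_half_double -mul2n -expnS.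
rewrite iterS nth_tm_morphism; last first.
  by rewrite size_iter_tm -ltn_half_double (leq_trans lti2) // leq_exp2l.
rewrite IHn // [in RHS]iterS nth_tm_morphism //.
by rewrite size_iter_tm -ltn_half_double.
Qed.

Lemma thue_morse_iter n i : i < 2 ^ n ->
  nth false (iter n tm_morphism [:: false]) i = thue_morse i.
Proof.
have stable m k : i < 2 ^ m ->
    nth false (iter (k + m) tm_morphism [:: false]) i =
    nth false (iter m tm_morphism [:: false]) i.
  move=> ltim; elim: k => // k IHk; rewrite addSn nth_iter_tmS ?IHk //.
  by rewrite (leq_trans ltim) // leq_exp2l // leq_addl.
move=> lti; rewrite /thue_morse -(stable n i lti) addnC stable //.
exact: ltn_expl.
Qed.

Lemma thue_morse0 : thue_morse 0 = false. Proof. by []. Qed.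

Lemma thue_morse_half i : thue_morse i = odd i (+) thue_morse i./2.
Proof.
have lti : i./2 < 2 ^ i.
  by apply: leq_ltn_trans (ltn_expl i (ltnSn 1)); rewrite -{2}(odd_double_half i) -addnn addnA leq_addl.
have lti1 : i < (2 ^ i).*2 by rewrite -ltn_half_double.
rewrite -[LHS](@thue_morse_iter i.+1) ?expnS ?mul2n //.
by rewrite iterS nth_tm_morphism ?size_iter_tm // thue_morse_iter.
Qed.

Lemma thue_morse_fixpoint : is_tm_fixpoint thue_morse.
Proof.
move=> n; apply: (@eq_from_nth _ false); first by rewrite size_mkseq.
rewrite size_tm_morphism size_mkseq => i lti.
rewrite nth_tm_morphism ?size_mkseq // !nth_mkseq ?ltn_half_double //.
by rewrite -thue_morse_half.
Qed.

Lemma tm_fixpoint_uniq t : is_tm_fixpoint t -> t 0 = false -> t =1 thue_morse.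
Proof.
move=> fix_t t0 n; have [m] := ubnP n; elim: m n => // m IHm [|n] ltnm.
  by rewrite t0.
have ltn2 : n.+1 < n.+1.*2 by rewrite -addnn -[X in X < _]addn0 ltn_add2l.
have := congr1 (fun s => nth false s n.+1) (fix_t n.+1).
rewrite size_tm_morphism size_mkseq nth_mkseq // => <-.
have lth : n.+1./2 < n.+1 by rewrite ltn_half_double.
rewrite nth_tm_morphism ?size_mkseq // nth_mkseq // thue_morse_half IHm //.
exact: leq_trans lth _.
Qed.

(* Main.v *)
Require Import Defs.
From HB Require Import structures.
From mathcomp Require Import all_boot all_order all_algebra.
From mathcomp Require Import boolp classical_sets cardinality.
From mathcomp Require Import zify.

Set Implicit Arguments.
Unset Strict Implicit.
Unset Printing Implicit Defensive.

Local Open Scope nat_scope.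

(** Write [d_a n] for [t n (+) t (n + a)]. If [n = r + 2 n'] and [a = s + 2 a'],
    then [d_a n = s (+) d_(a' + (r && s)) n'], so that the least [n] with
    [d_a n = x] and [d_b n = y] is determined by the same data for the halves
    of [a] and [b], possibly with a carry. Reading the binary digits of [a] and
    [b] from the top, the sixteen excesses [3 n - 5 b], one for each pair of
    carries and each [(x, y)], therefore evolve deterministically. An excess
    greater than 5 can never become nonpositive again and one less than -3
    remains so; hence they may be truncated to a finite range, and only
    finitely many states occur. Checking them proves (a). For (b), the pair
    [(2, 3)] attains the bound, and doubling a pair doubles its least [n]. *)

Lemma thue_morse_bit_double (r : bool) (n : nat) :
  thue_morse (r + n.*2) = r (+) thue_morse n.
Proof. by rewrite thue_morse_half half_bit_double oddD odd_double oddb addbF. Qed.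

(** * Upper bound *)

(* An excess table lists, in lexicographic order of [(c, d, x, y)], bounds for
   the pairs [(a + c, b + d)]. The entry [z] stands for the excess [z - 4], and
   any [z >= 10] for the absence of a bound. *)
Definition excess (v : seq nat) (c d x y : bool) : nat :=
  nth 10 v (8 * c + 4 * d + 2 * x + y).

Definition excess_table (F : bool -> bool -> bool -> bool -> nat) : seq nat :=
  [seq F p.1.1 p.1.2 p.2.1 p.2.2 |
    p <- [seq (cd, xy) | cd <- [seq (c, d) | c <- [:: false; true],
                                             d <- [:: false; true]],
                         xy <- [seq (x, y) | x <- [:: false; true],
                                             y <- [:: false; true]]]].

Lemma excess_tableE F c d x y : excess (excess_table F) c d x y = F c d x y.
Proof. by case: c d x y => [] [] [] []. Qed.

(** All entries are measured against the same [5 * b], whatever the carry [d]. *)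
Definition excess_sound (v : seq nat) (a b : nat) : Prop :=
  forall c d x y, excess v c d x y < 10 ->
  exists n, [/\ thue_morse n (+) thue_morse (n + (a + c)) = x,
                thue_morse n (+) thue_morse (n + (b + d)) = y &
                3 * n + 4 <= 5 * b + excess v c d x y].

(* The two arguments of [minn] come from the even and the odd candidates for
   [n]; truncated subtraction cuts off excesses below -4. *)
Definition excess_step (v : seq nat) (s u : bool) : seq nat :=
  excess_table (fun c d x y =>
    let x' := x (+) (s (+) c) in let y' := y (+) (u (+) d) in
    minn 10 (minn (2 * excess v (s && c) (u && d) x' y' - (4 + 5 * u))
                  (2 * excess v (s || c) (u || d) x' y' + 3 - (4 + 5 * u)))).

(** Adding the digits [r], [s], [c] leaves parity [r (+) s (+) c] and carries their majority; [r]
    cancels in the difference. *)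
Lemma thue_morse_diff_double (r s c : bool) (n a : nat) :
  thue_morse (r + n.*2) (+) thue_morse (r + n.*2 + (s + a.*2 + c)) =
  (s (+) c) (+)
    (thue_morse n (+) thue_morse (n + (a + (if r then s || c else s && c)))).
Proof.
have -> : r + n.*2 + (s + a.*2 + c) =
    (r (+) s (+) c) + (n + (a + (if r then s || c else s && c))).*2.
  by case: r s c => [] [] [] /=; lia.
rewrite !thue_morse_bit_double.
by case: r s c (thue_morse _) (thue_morse _) => [] [] [] [] [].
Qed.

Lemma excess_sound_step v a b (s u : bool) :
  excess_sound v a b ->
  excess_sound (excess_step v s u) (s + a.*2) (u + b.*2).
Proof.
move=> sound c d x y; rewrite excess_tableE; cbv zeta.
set x' := x (+) (s (+) c); set y' := y (+) (u (+) d).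
set z0 := excess v (s && c) _ _ _; set z1 := excess v (s || c) _ _ _ => /= lt10.
(* With [r + 2 n] and [u + 2 b], the excess becomes [2 (3 n - 5 b) + 3 r - 5 u]; shifting both
   excesses by 4 gives [4 + 5 u]. *)
have lift (r : bool) z :
    z = (if r then z1 else z0) -> z < 10 ->
    exists n, [/\ thue_morse n (+) thue_morse (n + (s + a.*2 + c)) = x,
                  thue_morse n (+) thue_morse (n + (u + b.*2 + d)) = y &
                  3 * n + 4 <= 5 * (u + b.*2) + (2 * z + 3 * r - (4 + 5 * u))].
  move=> zE z_lt.
  have := sound (if r then s || c else s && c) (if r then u || d else u && d) x' y'.
  have -> : excess v (if r then s || c else s && c)
                     (if r then u || d else u && d) x' y' = z.
    by rewrite zE; case: (r).
  case/(_ z_lt) => n [nx ny le_n]; exists (r + n.*2).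
  rewrite !thue_morse_diff_double nx ny /x' /y'; split.
  - by rewrite addbC addbK.
  - by rewrite addbC addbK.
  - by case: (r) (u) => [] [] /=; lia.
have [le01 | lt10'] := leqP (2 * z0 - (4 + 5 * u)) (2 * z1 + 3 - (4 + 5 * u)).
  (* Absent bounds stay absent: [z0 >= 10] would yield at least [20 - 9]. *)
  have z0_lt : z0 < 10 by case: (u) lt10 le01 => /=; lia.
  have [n [nx ny le_n]] := lift false z0 erefl z0_lt.
  by exists n; split=> //; case: (u) lt10 le01 le_n => /=; lia.
have z1_lt : z1 < 10 by case: (u) lt10 lt10' => /=; lia.
have [n [nx ny le_n]] := lift true z1 erefl z1_lt.
by exists n; split=> //; case: (u) lt10 lt10' le_n => /=; lia.
Qed.

(** Since [t] starts with 0, 1, 1, each attainable pair occurs at [n = 0] (entry 4) or [n = 1]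
    (entry 7); without a carry the difference is always 0. *)
Definition excess_init : seq nat :=
  [:: 4; 10; 10; 10; 7; 4; 10; 10; 7; 10; 4; 10; 7; 10; 10; 4].

Lemma excess_sound_init : excess_sound excess_init 0 0.
Proof.
by move=> [] [] [] [] //= _; first [by exists 0 | by exists 1].
Qed.

(* A state also records whether the digits read so far satisfy [a = b], and
   whether [0 < a]. *)
Definition state : Type := (seq nat * bool * bool)%type.

Definition state_init : state := (excess_init, true, false).

Definition state_step (q : state) (s u : bool) : state :=
  let: (v, e, p) := q in (excess_step v s u, e && (s == u), p || s).

(** As long as the leading digits agree, [a <= b] forces [s <= u]. *)
Definition digits_ok (q : state) (s u : bool) : bool := q.1.2 ==> (s <= u).

Definition next_states (q : state) : seq state :=
  [seq state_step q su.1 su.2 |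
    su <- [:: (false, false); (false, true); (true, false); (true, true)] &
    digits_ok q su.1 su.2].

Definition add_next_states (qs : seq state) : seq state :=
  undup (qs ++ flatten (map next_states qs)).

(** Twelve rounds suffice for the closure checked next. *)
Definition reachable_states : seq state :=
  Eval vm_compute in iter 12 add_next_states [:: state_init].

Lemma reachable_states_closed :
  all (fun q => all (mem reachable_states) (next_states q)) reachable_states.
Proof. by vm_compute. Qed.

Lemma reachable_state_step q s u :
  q \in reachable_states -> digits_ok q s u ->
  state_step q s u \in reachable_states.
Proof.
move=> q_reach ok.
have /allP := allP reachable_states_closed _ q_reach; apply.
apply/mapP; exists (s, u) => //; rewrite mem_filter ok.
by case: s u {ok} => [] [].
Qed.

(** Entry 4 is excess 0, so this is the bound [3 n <= 5 b] for [0 < a < b]. *)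
Lemma reachable_states_safe (v : seq nat) :
  (v, false, true) \in reachable_states -> excess v false false true true <= 4.
Proof.
have safe : all (fun q : state => (~~ q.1.2 && q.2) ==>
    (excess q.1.1 false false true true <= 4)) reachable_states by vm_compute.
by move/(allP safe).
Qed.

Lemma reachable_state_exists a b : a <= b ->
  exists2 v, (v, a == b, 0 < a) \in reachable_states & excess_sound v a b.
Proof.
have [m] := ubnP b; elim: m a b => // m IHm a b lt_bm le_ab.
have [b0 | b_gt0] := posnP b.
  have a0 : a = 0 by lia.
  by exists excess_init; rewrite b0 a0 //; exact: excess_sound_init.
have le_half : a./2 <= b./2 by exact: half_leq.
have lt_half : b./2 < m by lia.
have [v v_reach v_sound] := IHm _ _ lt_half le_half.
exists (excess_step v (odd a) (odd b)); last first.
  by rewrite -{2}(odd_double_half a) -{2}(odd_double_half b);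
    exact: excess_sound_step.
have ok : digits_ok (v, a./2 == b./2, 0 < a./2) (odd a) (odd b).
  by apply/implyP => /= /eqP eq_half; lia.
have := reachable_state_step v_reach ok; rewrite /state_step.
have -> : (a./2 == b./2) && (odd a == odd b) = (a == b) by lia.
by have -> : (0 < a./2) || odd a = (0 < a) by lia.
Qed.

Lemma thue_morse_notin n a b :
  (thue_morse n \notin [:: thue_morse (n + a); thue_morse (n + b)]) =
  (thue_morse n (+) thue_morse (n + a)) && (thue_morse n (+) thue_morse (n + b)).
Proof.
rewrite !inE.
by case: (thue_morse n) (thue_morse (n + a)) (thue_morse (n + b)) => [] [] [].
Qed.

Lemma thue_morse_avoid a b : 0 < a -> a < b ->
  exists2 n, 3 * n <= 5 * b &
    thue_morse n \notin [:: thue_morse (n + a); thue_morse (n + b)].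
Proof.
move=> a_gt0 lt_ab; have [v] := reachable_state_exists (ltnW lt_ab).
rewrite (ltn_eqF lt_ab) a_gt0 => /reachable_states_safe safe sound.
have [|n [na nb le_n]] := sound false false true true; first by lia.
by exists n; [lia | rewrite thue_morse_notin -[a]addn0 -[b]addn0 na nb].
Qed.

(** * Optimality *)

Lemma thue_morse_mem_doubling k i : i < 5 * 2 ^ k ->
  thue_morse i \in [:: thue_morse (i + 2 * 2 ^ k); thue_morse (i + 3 * 2 ^ k)].
Proof.
elim: k i => [|k IHk] i; first by move: i; do 5![case=> //].
rewrite expnS => lt_i; have /IHk : i./2 < 5 * 2 ^ k by lia.
rewrite -{4 5 6}(odd_double_half i) -!addnA.
have -> : (i./2).*2 + 2 * (2 * 2 ^ k) = (i./2 + 2 * 2 ^ k).*2 by lia.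
have -> : (i./2).*2 + 3 * (2 * 2 ^ k) = (i./2 + 3 * 2 ^ k).*2 by lia.
(* All three positions share the last digit of [i], which cancels. *)
by rewrite !thue_morse_bit_double !inE !(inj_eq (@addbI _)).
Qed.

Import Order.TTheory GRing.Theory Num.Theory.

Lemma ltr_five_thirds (i b : nat) :
  (i%:R < 5 / 3 * b%:R :> rat)%R = (3 * i < 5 * b).
Proof. by rewrite mulrAC ltr_pdivlMr // -!natrM ltr_nat mulnC. Qed.

Lemma thue_morse_mem_large (m : nat) : exists a b : nat,
  [/\ 1 <= a, a < b, m < b &
    forall i : nat, (i%:R < 5 / 3 * b%:R :> rat)%R ->
      thue_morse i \in [:: thue_morse (i + a); thue_morse (i + b)]].
Proof.
have lt_m : m < 2 ^ m by exact: ltn_expl.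
exists (2 * 2 ^ m), (3 * 2 ^ m); split; [lia | lia | lia |] => i.
by rewrite ltr_five_thirds => lt_i; apply: thue_morse_mem_doubling; lia.
Qed.

Theorem theorem12 :
  (forall a b : nat, 1 <= a -> a < b ->
     exists n : nat, (n%:R <= 5 / 3 * b%:R :> rat)%R /\
       thue_morse n \notin [:: thue_morse (n + a); thue_morse (n + b)])
  /\
  (forall m : nat, exists a b : nat,
     [/\ 1 <= a, a < b, m < b &
       forall i : nat, (i%:R < 5 / 3 * b%:R :> rat)%R ->
         thue_morse i \in [:: thue_morse (i + a); thue_morse (i + b)]])
  /\
  (forall B : nat -> rat,
     (forall b : nat, 0 < b -> (B b < 5 / 3 * b%:R)%R) ->
     infinite_set
       [set p : nat * nat |
         [/\ 1 <= p.1, p.1 < p.2 &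
           ~ exists n : nat, (n%:R <= B p.2)%R /\
               thue_morse n \notin
                 [:: thue_morse (n + p.1); thue_morse (n + p.2)]]]%classic).
Proof.
split; [|split; first exact: thue_morse_mem_large].
  move=> a b a_gt0 /(thue_morse_avoid a_gt0) [n le_n n_notin].
  exists n; split=> //.
  by rewrite mulrAC ler_pdivlMr // -!natrM ler_nat mulnC.
move=> B ltB /finite_seqP [ps psE].
(* A counterexample with [b] beyond every listed second component contradicts finiteness. *)
have [a [b [a_gt0 lt_ab lt_max mem_t]]] :=
  thue_morse_mem_large (\max_(p <- ps) p.2).
suff ab_ps : (a, b) \in ps.
  by have := @leq_bigmax_seq _ ps xpredT snd _ ab_ps isT; rewrite leqNgt lt_max.
suff : [set` ps]%classic (a, b) by [].
rewrite -psE; split=> // -[n [le_n]].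
by rewrite mem_t // (le_lt_trans le_n) // ltB // (leq_ltn_trans _ lt_ab).
Qed.
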